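(* Suppose that $K$ is closed at infinity and that the POP $\inf\{f(\mathbf{x}):\mathbf{x}\in K\}$ admits a correlative sparsity pattern $(\mathbf{x}(1),\dots,\mathbf{x}(p))$ satisfying the running intersection property. Then for every $\epsilon>0$, $f_k\rightarrow f^{(\epsilon)}$ as $k\rightarrow\infty$.
   Context: Polynomial optimization problem (POP). Let $\mathbf{x}=(x_1,\dots,x_n)$, $f,g_1,\dots,g_m\in\mathbb{R}[\mathbf{x}]$, $K=\{\mathbf{x}\in\mathbb{R}^n : g_j(\mathbf{x})\ge 0,\ j=1,\dots,m\}$, $f_{\min}=\inf_{\mathbf{x}\in K} f(\mathbf{x})$; it is assumed throughout that $f_{\min}>-\infty$. Put $d=\deg(f)$, $d_0=2\lceil d/2\rceil$. Homogenization. Let $\tilde{\mathbf{x}}=(x_0,x_1,\dots,x_n)$. For $q\in\mathbb{R}[\mathbf{x}]$, $\tilde q(\tilde{\mathbf{x}})=x_0^{\deg(q)}q(\mathbf{x}/x_0)$. Define $\widetilde K=\{\tilde{\mathbf{x}}\in\mathbb{R}^{n+1} : \tilde g_j(\tilde{\mathbf{x}})\ge 0\ (j=1,\dots,m),\ x_0\ge 0,\ \|\tilde{\mathbf{x}}\|^2=1\}$. $K$ is closed at infinity if $\widetilde K$ equals the closure of $\widetilde K\cap\{x_0>0\}$. Correlative sparsity. Variable sets $\mathbf{x}(1),\dots,\mathbf{x}(p)\subseteq\{x_1,\dots,x_n\}$ with union $\{x_1,\dots,x_n\}$ form a correlative sparsity pattern (csp) of the POP if $f=\sum_{\ell=1}^p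 f_\ell$ with $f_\ell\in\mathbb{R}[\mathbf{x}(\ell)]$, and there is a partition $\{J_1,\dots,J_p\}$ of $\{1,\dots,m\}$ with $g_j\in\mathbb{R}[\mathbf{x}(\ell)]$ for all $j\in J_\ell$. The csp satisfies the running intersection property (RIP) if for every $\ell\in\{1,\dots,p-1\}$ there is $s\in\{1,\dots,\ell\}$ with $\mathbf{x}(\ell+1)\cap\bigcup_{j=1}^{\ell}\mathbf{x}(j)\subseteq\mathbf{x}(s)$. Sparse homogenized reformulation. Let $\tilde{\mathbf{x}}(\ell)=(x_0,\mathbf{x}(\ell))$, $\mathbf{w}=(w_1,\dots,w_p)$ auxiliary variables, $h_\ell=\|\tilde{\mathbf{x}}(\ell)\|^2+w_\ell^2-1$, and $$\widetilde K_s^1=\{(\tilde{\mathbf{x}},\mathbf{w})\in\mathbb{R}^{n+1+p} : x_0\ge0,\ \tilde g_j(\tilde{\mathbf{x}})\ge0\ (j=1,\dots,m),\ h_\ell=0\ (\ell=1,\dots,p)\}.$$ For $\epsilon\ge0$ let $F_\epsilon=\tilde f(\tilde{\mathbf{x}})+\epsilon\big(\sum_{i=0}^n x_i^{d_0}+\sum_{\ell=1}^p w_\ell^{d_0}\big)$ and let $f^{(\epsilon)}$ be the supremum of all $\gamma\in\mathbb{R}$ such that $F_\epsilon-\gamma x_0^d\ge0$ on $\widetilde K_s^1$. SOS relaxations. For a set of variables $V$, $\Sigma[V]$ denotes the sums of squares in $\mathbb{R}[V]$, and $\mathbb{R}[V]_s$, $\Sigma[V]_s$ the elements of degree at most $s$.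 For $h\in\mathbb{R}[V]$ and a finite set $G\subset\mathbb{R}[V]$, $$\mathrm{Ideal}[h,V]_{2k}=h\cdot\mathbb{R}[V]_{2k-\deg(h)},\qquad \mathrm{QM}[G,V]_{2k}=\Sigma[V]_{2k}+\sum_{g\in G} g\cdot\Sigma[V]_{2k-2\lceil\deg(g)/2\rceil}.$$ Let $V_\ell=\tilde{\mathbf{x}}(\ell)\cup\{w_\ell\}$. For each integer $k\ge\max\{\lceil d/2\rceil,\lceil\deg(g_1)/2\rceil,\dots,\lceil\deg(g_m)/2\rceil\}$, $f_k$ (depending on $\epsilon$) is the supremum of all $\gamma\in\mathbb{R}$ such that $$F_\epsilon-\gamma x_0^d\in\sum_{\ell=1}^p\Big(\mathrm{Ideal}[h_\ell,V_\ell]_{2k}+\mathrm{QM}[\{x_0\}\cup\{\tilde g_j\}_{j\in J_\ell},V_\ell]_{2k}\Big).$$ *)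

(* Defs.v *)
From HB Require Import structures.
From mathcomp Require Import all_boot all_order all_algebra.
From mathcomp Require Import all_classical all_reals.
From mathcomp Require Import ereal topology normedtype sequences.
(* The notations of mpoly are incompatible with those of mathcomp-analysis. *)
From mathcomp Require Import -(notations) mpoly.

Set Implicit Arguments.
Unset Strict Implicit.
Unset Printing Implicit Defensive.

Import Order.TTheory GRing.Theory Num.Theory.
Import numFieldNormedType.Exports.

Local Open Scope classical_set_scope.
Local Open Scope ring_scope.

Notation "{ 'mpoly' T [ n ] }" := (mpoly n T)
  (format "{ 'mpoly'  T [ n ] }") : type_scope.

Section Polynomials.
Variables (R : realType) (n : nat).
Implicit Types (p q h : {mpoly R[n]}) (V : {set 'I_n}) (s : int).

Definition mvar (i : 'I_n) : {mpoly R[n]} := mpolyX R (mnm1 i).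

(* [msize] is the total degree plus one; here deg 0 = 0. *)
Definition tdeg q : nat := (msize q).-1.

Definition polyIn V : set {mpoly R[n]} :=
  [set q | forall m, m \in msupp q -> forall i, m i != 0%N -> i \in V].

(* The bound is an integer so that only 0 has degree at most s when s < 0;
   this matters for the truncations 2k - deg h below. *)
Definition degLe s : set {mpoly R[n]} :=
  [set q | forall m, m \in msupp q -> (mdeg m)%:Z <= s].

Definition sos V : set {mpoly R[n]} :=
  [set q | exists2 r : seq {mpoly R[n]},
     (forall t, t \in r -> polyIn V t) & q = \sum_(t <- r) t ^+ 2].

Definition truncIdeal h V k : set {mpoly R[n]} :=
  [set h * q | q in polyIn V `&` degLe ((2 * k)%N%:Z - (tdeg h)%:Z)].

(* The finite set G is given by a list; as sums of squares are closed under
   addition, repetitions in the list are immaterial. *)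
Definition truncQM (G : seq {mpoly R[n]}) V k : set {mpoly R[n]} :=
  [set q | exists sigma0 (sigma : {mpoly R[n]} -> {mpoly R[n]}),
     [/\ (sos V `&` degLe (2 * k)%N%:Z) sigma0,
         forall g, g \in G ->
           (sos V `&` degLe ((2 * k)%N%:Z - (2 * uphalf (tdeg g))%N%:Z)) (sigma g)
       & q = sigma0 + \sum_(g <- G) g * sigma g]].

(* x_0 is the coordinate [ord0] and x_i (1 <= i <= n) is [lift ord0 i]. *)
Definition homogenize q : {mpoly R[n.+1]} :=
  \sum_(m <- msupp q) mcoeff m q *:
    (mpolyX R (mnm1 ord0) ^+ (tdeg q - mdeg m) *
     \prod_(i < n) mpolyX R (mnm1 (lift ord0 i)) ^+ m i).

End Polynomials.

Section POP.
Variables (R : realType) (n m : nat).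
Variables (f : {mpoly R[n]}) (g : 'I_m -> {mpoly R[n]}).

Definition feasible : set 'rV[R]_n :=
  [set x : 'rV[R]_n | forall j, 0 <= meval (x 0) (g j)].

Definition fmin : \bar R := ereal_inf [set (meval (x 0) f)%:E | x in feasible].

Definition Ktilde : set 'rV[R]_n.+1 :=
  [set x : 'rV[R]_n.+1 | [/\ forall j, 0 <= meval (x 0) (homogenize (g j)),
               0 <= x 0 ord0
             & \sum_i x 0 i ^+ 2 = 1]].

Definition closed_at_infinity : Prop :=
  Ktilde = closure (Ktilde `&` [set x : 'rV[R]_n.+1 | 0 < x 0 ord0]).

Definition csp p (X : 'I_p -> {set 'I_n}) (J : 'I_p -> {set 'I_m}) : Prop :=
  [/\ (\bigcup_l X l)%SET = [set: 'I_n]%SET,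
      exists2 fl : 'I_p -> {mpoly R[n]},
        (forall l, polyIn (X l) (fl l)) & f = \sum_l fl l,
      (\bigcup_l J l)%SET = [set: 'I_m]%SET,
      forall l l', l != l' -> (J l :&: J l')%SET = finset.set0
    & forall l j, j \in J l -> polyIn (X l) (g j)].

End POP.

Definition RIP n p (X : 'I_p -> {set 'I_n}) : Prop :=
  forall l : 'I_p, (0 < l)%N ->
    exists2 s : 'I_p, (s < l)%N &
      X l :&: (\bigcup_(j < p | (j < l)%N) X j)%SET \subset X s.

(* Polynomials in the variables (x_0, x_1, ..., x_n, w_1, ..., w_p) have their
   variables indexed by 'I_(n.+1 + p), in this order. *)
Section SparseReformulation.
Variables (R : realType) (n m p : nat).
Variables (f : {mpoly R[n]}) (g : 'I_m -> {mpoly R[n]}).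
Variables (X : 'I_p -> {set 'I_n}) (J : 'I_p -> {set 'I_m}) (eps : R).

Definition ix0 : 'I_(n.+1 + p) := lshift p ord0.
Definition ix (i : 'I_n) : 'I_(n.+1 + p) := lshift p (lift ord0 i).
Definition iw (l : 'I_p) : 'I_(n.+1 + p) := rshift n.+1 l.

Definition tilde (q : {mpoly R[n]}) : {mpoly R[n.+1 + p]} :=
  comp_mpoly [tuple mvar R (lshift p i) | i < n.+1] (homogenize q).

Definition hpol (l : 'I_p) : {mpoly R[n.+1 + p]} :=
  mvar R ix0 ^+ 2 + \sum_(i in X l) mvar R (ix i) ^+ 2 + mvar R (iw l) ^+ 2 - 1.

Definition Vset (l : 'I_p) : {set 'I_(n.+1 + p)} :=
  (ix0 |: (iw l |: [set ix i | i in X l]))%SET.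

Definition Ks1 : set 'rV[R]_(n.+1 + p) :=
  [set z : 'rV[R]_(n.+1 + p) | [/\ 0 <= z 0 ix0,
               forall j, 0 <= meval (z 0) (tilde (g j))
             & forall l, meval (z 0) (hpol l) = 0]].

Definition d0 : nat := (2 * uphalf (tdeg f))%N.

Definition Feps : {mpoly R[n.+1 + p]} :=
  tilde f + eps *: (mvar R ix0 ^+ d0 + \sum_(i < n) mvar R (ix i) ^+ d0
                    + \sum_(l < p) mvar R (iw l) ^+ d0).

Definition shifted (gamma : R) : {mpoly R[n.+1 + p]} :=
  Feps - gamma *: mvar R ix0 ^+ tdeg f.

Definition f_eps : \bar R :=
  ereal_sup [set gamma%:E | gamma in
    [set gamma : R | forall z, Ks1 z -> 0 <= meval (z 0) (shifted gamma)]].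

Definition sparse_cone (k : nat) : set {mpoly R[n.+1 + p]} :=
  [set q | exists a b : 'I_p -> {mpoly R[n.+1 + p]},
     [/\ forall l, truncIdeal (hpol l) (Vset l) k (a l),
         forall l, truncQM (mvar R ix0 :: [seq tilde (g j) | j <- enum (J l)])
                     (Vset l) k (b l)
       & q = \sum_(l < p) (a l + b l)]].

Definition f_relax (k : nat) : \bar R :=
  ereal_sup [set gamma%:E | gamma in
    [set gamma : R | sparse_cone k (shifted gamma)]].

End SparseReformulation.

(* Main.v *)
Require Import Defs.
From HB Require Import structures.
From mathcomp Require Import all_boot all_order all_algebra.
From mathcomp Require Import all_classical all_reals.
From mathcomp Require Import ereal topology normedtype sequences.
From mathcomp Require Import -(notations) mpoly.
From mathcomp Require Import derive realfun ring lra zify.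

Import Order.TTheory GRing.Theory Num.Theory.
Import numFieldNormedType.Exports.
Local Open Scope classical_set_scope.
Local Open Scope ring_scope.

(** Both directions of the limit are elementary apart from one representation
    theorem. An element of the truncated cone is nonnegative on [Ks1], so
    [f_relax k <= f_eps] for all [k] ([f_relax_le]). Conversely let
    [gamma < f_eps]. Then [F_eps - gamma x_0^d] is strictly positive on [Ks1]
    ([shifted_positive]): where [x_0^d > 0] there is room between [gamma] and
    [f_eps]; elsewhere [x_0 = 0], the form [f~(0, x)] is nonnegative because
    closedness at infinity makes the point a limit of rays through feasible
    points, on which [f] is bounded below, and the perturbation adds
    [eps] times a positive sum of even powers. It remains to write a polynomial
    that is positive on [Ks1], and is a sum of polynomials in the blocks [V_l],
    as a sum of certificates each living in one block ([sparse_putinar]); the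
    degrees of this one certificate are bounded, so it lies in the truncated
    cone for all large [k].

    The sparse Positivstellensatz is proved in three moves.

    - Penalties. On the compact box [-1, 1]^D, adding a multiple of the squared
      equations and subtracting [g * sigma(g)], with [sigma(g)] a multiple of a
      high even power of [1 - g/M], approximates an exact penalty; this makes
      the polynomial positive on the whole box without leaving the set of sums
      over the blocks ([exact_penalty], [hinge_approx], [square_approx]).

    - Splitting. The coefficients of a polynomial in the tensor Bernstein basis
      of degree [N] converge uniformly to its values at the grid points
      ([grid_coef_near]); hence for large [N] the coefficients of the sum are
      nonnegative. They are sums of functions of the grid coordinates of single
      blocks, and the running intersection property allows one to move
      functions between blocks until each summand is itself nonnegative: the
      minimum of the last summand over the coordinates that are not shared is
      handed to the block that contains the shared ones ([rip_redistribute]).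
      On the finite grid this minimum raises no question of continuity.

    - Sums of squares. Modulo the equation of the unit sphere in the variables
      of a block, sums of squares are closed under products and contain
      [1 + x] and [1 - x] for every variable [x] of the block
      ([sosSphere_coord]), so they contain the Bernstein polynomials of the
      block ([sosSphere_grid]). *)

Set Implicit Arguments.
Unset Strict Implicit.
Unset Printing Implicit Defensive.

(** * Polynomials in a subset of the variables, sums of squares *)

Lemma polyInP (R : realType) n (V : {set 'I_n}) (q : {mpoly R[n]}) :
  polyIn V q <-> forall m, m \in msupp q -> forall i, i \notin V -> m i = 0%N.
Proof.
split=> [Vq m mq i iV|Vq m mq i mi].
  by apply/eqP; apply: contraNT iV; apply: Vq.
by apply: contraNT mi => iV; rewrite (Vq m).
Qed.

Lemma polyInD (R : realType) n (V : {set 'I_n}) (p q : {mpoly R[n]}) :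
  polyIn V p -> polyIn V q -> polyIn V (p + q).
Proof.
move=> Vp Vq m /msuppD_le; rewrite mem_cat => /orP[]; [exact: Vp|exact: Vq].
Qed.

Lemma polyInM (R : realType) n (V : {set 'I_n}) (p q : {mpoly R[n]}) :
  polyIn V p -> polyIn V q -> polyIn V (p * q).
Proof.
move=> Vp Vq m /msuppM_le /allpairsP[[m1 m2]/= [m1p m2q ->]] i.
rewrite mnmDE addn_eq0 negb_and => /orP[]; [exact: Vp|exact: Vq].
Qed.

Lemma polyInC (R : realType) n (V : {set 'I_n}) (c : R) : polyIn V (mpolyC n c).
Proof.
apply/polyInP => m; rewrite msuppC; case: ifP => // _.
by rewrite inE => /eqP-> i _; rewrite mnmE.
Qed.

Lemma polyIn0 (R : realType) n (V : {set 'I_n}) : polyIn V (0 : {mpoly R[n]}).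
Proof. by rewrite -(mpolyC0 n); apply: polyInC. Qed.

Lemma polyIn1 (R : realType) n (V : {set 'I_n}) : polyIn V (1 : {mpoly R[n]}).
Proof. by rewrite -(mpolyC1 n); apply: polyInC. Qed.

Lemma polyInZ (R : realType) n (V : {set 'I_n}) c (p : {mpoly R[n]}) :
  polyIn V p -> polyIn V (c *: p).
Proof. by move=> Vp; rewrite -mul_mpolyC; apply: polyInM => //; apply: polyInC. Qed.

Lemma polyInN (R : realType) n (V : {set 'I_n}) (p : {mpoly R[n]}) :
  polyIn V p -> polyIn V (- p).
Proof. by rewrite -scaleN1r; apply: polyInZ. Qed.

Lemma polyInB (R : realType) n (V : {set 'I_n}) (p q : {mpoly R[n]}) :
  polyIn V p -> polyIn V q -> polyIn V (p - q).
Proof. by move=> Vp Vq; apply: polyInD => //; apply: polyInN. Qed.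

Lemma polyInXn (R : realType) n (V : {set 'I_n}) (p : {mpoly R[n]}) k :
  polyIn V p -> polyIn V (p ^+ k).
Proof.
move=> Vp; elim: k => [|k IH]; first by rewrite expr0; apply: polyIn1.
by rewrite exprS; apply: polyInM.
Qed.

Lemma polyIn_sum (R : realType) n (V : {set 'I_n}) (I : Type) (r : seq I)
    (P : pred I) (F : I -> {mpoly R[n]}) :
  (forall i, P i -> polyIn V (F i)) -> polyIn V (\sum_(i <- r | P i) F i).
Proof. by move=> VF; apply: big_ind => //; [exact: polyIn0|move=> *; exact: polyInD]. Qed.

Lemma polyIn_prod (R : realType) n (V : {set 'I_n}) (I : Type) (r : seq I)
    (P : pred I) (F : I -> {mpoly R[n]}) :
  (forall i, P i -> polyIn V (F i)) -> polyIn V (\prod_(i <- r | P i) F i).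
Proof. by move=> VF; apply: big_ind => //; [exact: polyIn1|move=> *; exact: polyInM]. Qed.

Lemma polyIn_mvar (R : realType) n (V : {set 'I_n}) i : i \in V -> polyIn V (mvar R i).
Proof.
move=> iV; apply/polyInP => m; rewrite /mvar msuppX inE => /eqP-> j jV.
by rewrite mnm1E; case: eqP jV => // <-; rewrite iV.
Qed.

Section Sos.
Variables (R : realType) (n : nat) (V : {set 'I_n}).
Implicit Types (p q s : {mpoly R[n]}).

Lemma sos_sqr p : polyIn V p -> sos V (p ^+ 2).
Proof.
move=> Vp; exists [:: p]; last by rewrite big_seq1.
by move=> t; rewrite inE => /eqP->.
Qed.

Lemma sos0 : sos V (0 : {mpoly R[n]}).
Proof. by exists [::]; rewrite ?big_nil. Qed.

Lemma sos_const c : 0 <= c -> sos V (mpolyC n c : {mpoly R[n]}).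
Proof.
move=> c0; rewrite -(sqr_sqrtr c0) rmorphXn /=.
by apply: sos_sqr; apply: polyInC.
Qed.

Lemma sosD s t : sos V s -> sos V t -> sos V (s + t).
Proof.
move=> [r1 V1 ->] [r2 V2 ->]; exists (r1 ++ r2); last by rewrite big_cat.
by move=> u; rewrite mem_cat => /orP[]; [exact: V1|exact: V2].
Qed.

Lemma sosM s t : sos V s -> sos V t -> sos V (s * t).
Proof.
move=> [r1 V1 ->] [r2 V2 ->]; exists [seq a * b | a <- r1, b <- r2].
  by move=> u /allpairsP[[a b]/= [ar br ->]]; apply: polyInM; [exact: V1|exact: V2].
rewrite big_allpairs_dep mulr_suml; apply: eq_bigr => a _.
by rewrite mulr_sumr; apply: eq_bigr => b _; rewrite exprMn.
Qed.

Lemma sos_sum (I : Type) (r : seq I) (P : pred I) (F : I -> {mpoly R[n]}) :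
  (forall i, P i -> sos V (F i)) -> sos V (\sum_(i <- r | P i) F i).
Proof. by move=> VF; apply: big_ind => //; [exact: sos0|move=> *; exact: sosD]. Qed.

Lemma sosZ c s : 0 <= c -> sos V s -> sos V (c *: s).
Proof. by move=> c0 Vs; rewrite -mul_mpolyC; apply: sosM => //; apply: sos_const. Qed.

Lemma sos_polyIn s : sos V s -> polyIn V s.
Proof.
move=> [r Vr ->]; rewrite big_seq; apply: polyIn_sum => t tr.
by apply: polyInXn; apply: Vr.
Qed.

Lemma sos_ge0 s v : sos V s -> 0 <= meval v s.
Proof.
move=> [r Vr ->]; rewrite raddf_sum /=; apply: sumr_ge0 => t _.
by rewrite rmorphXn /=; apply: sqr_ge0.
Qed.

End Sos.

(** * Sums of squares modulo the equation of a sphere *)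

Section SphereCone.
Variables (R : realType) (n : nat) (V : {set 'I_n}).
Implicit Types (p q s : {mpoly R[n]}).

Definition sphere_poly : {mpoly R[n]} := \sum_(i in V) mvar R i ^+ 2 - 1.

Definition sosSphere : set {mpoly R[n]} :=
  [set q | exists s r, [/\ sos V s, polyIn V r & q = s + sphere_poly * r]].

Lemma polyIn_sphere_poly : polyIn V sphere_poly.
Proof.
apply: polyInB; last exact: polyIn1.
apply: polyIn_sum => i iV.
by apply: polyInXn; apply: polyIn_mvar.
Qed.

Lemma sos_sosSphere s : sos V s -> sosSphere s.
Proof. by move=> Vs; exists s, 0; split; rewrite ?mulr0 ?addr0 //; apply: polyIn0. Qed.

Lemma sosSphereD p q : sosSphere p -> sosSphere q -> sosSphere (p + q).
Proof.
move=> [s [r [Vs Vr ->]]] [t [u [Vt Vu ->]]]; exists (s + t), (r + u).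
by split; [exact: sosD|exact: polyInD|rewrite mulrDr addrACA].
Qed.

(** Unlike a quadratic module, sums of squares modulo an ideal are stable under
    products; this is what makes products of linear factors available. *)
Lemma sosSphereM p q : sosSphere p -> sosSphere q -> sosSphere (p * q).
Proof.
move=> [s [r [Vs Vr ->]]] [t [u [Vt Vu ->]]].
exists (s * t), (r * t + s * u + sphere_poly * (r * u)).
split; [exact: sosM| |by ring].
have [Is It] := (sos_polyIn Vs, sos_polyIn Vt).
apply: polyInD (polyInM polyIn_sphere_poly (polyInM Vr Vu)).
by apply: polyInD; apply: polyInM.
Qed.

Lemma sosSphere_sum (I : Type) (r : seq I) (P : pred I) (F : I -> {mpoly R[n]}) :
  (forall i, P i -> sosSphere (F i)) -> sosSphere (\sum_(i <- r | P i) F i).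
Proof.
move=> VF; apply: big_ind => //; last by move=> *; exact: sosSphereD.
exact/sos_sosSphere/sos0.
Qed.

Lemma sosSphere_const c : 0 <= c -> sosSphere (mpolyC n c).
Proof. by move=> c0; apply/sos_sosSphere/sos_const. Qed.

Lemma sosSphereZ c p : 0 <= c -> sosSphere p -> sosSphere (c *: p).
Proof.
by move=> c0 ?; rewrite -mul_mpolyC; apply: sosSphereM => //; apply: sosSphere_const.
Qed.

Lemma sosSphere1 : sosSphere 1.
Proof. by rewrite -(mpolyC1 n); apply: sosSphere_const. Qed.

Lemma sosSphere_prod (I : Type) (r : seq I) (P : pred I) (F : I -> {mpoly R[n]}) :
  (forall i, P i -> sosSphere (F i)) -> sosSphere (\prod_(i <- r | P i) F i).
Proof.
move=> VF; apply: big_ind => //; [exact: sosSphere1|move=> *; exact: sosSphereM].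
Qed.

Lemma sosSphereX p k : sosSphere p -> sosSphere (p ^+ k).
Proof.
move=> Sp; elim: k => [|k IH]; first by rewrite expr0; apply: sosSphere1.
by rewrite exprS; apply: sosSphereM.
Qed.

(** A coordinate of a point of the unit sphere is at most 1 in absolute value;
    the certificate is [1 + c x = ((1 + c x)^2 + (1 - x^2)) / 2] where the
    equation of the sphere turns [1 - x^2] into the sum of the other squares. *)
Lemma sosSphere_coord i (c : R) : i \in V -> c ^+ 2 = 1 ->
  sosSphere (1 + c *: mvar R i).
Proof.
move=> iV c1.
have h2 : 2^-1 + 2^-1 = 1 :> R by lra.
exists (2^-1 *: ((1 + c *: mvar R i) ^+ 2 +
                \sum_(j in V | j != i) mvar R j ^+ 2)), (- mpolyC n 2^-1).
split; first last.
- set S := \sum_(j in V | j != i) _.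
  have -> : sphere_poly = mvar R i ^+ 2 + S - 1.
    by rewrite /sphere_poly (bigD1 i).
  rewrite -!mul_mpolyC.
  have cc : mpolyC n c ^+ 2 = 1 by rewrite -rmorphXn /= c1 mpolyC1.
  have hh : mpolyC n 2^-1 + mpolyC n 2^-1 = 1 :> {mpoly R[n]}.
    by rewrite -raddfD /= h2 mpolyC1.
  set x := mvar R i in S *; set C := mpolyC n c in cc *.
  set h := mpolyC n 2^-1 in hh *.
  transitivity ((h + h) * (1 + C * x) + h * ((C ^+ 2 - 1) * x ^+ 2)).
    by rewrite hh cc; ring.
  by ring.
- by apply: polyInN; apply: polyInC.
apply: sosZ; first by lra.
apply: sosD.
  apply: sos_sqr; apply: polyInD; first exact: polyIn1.
  by apply: polyInZ; apply: polyIn_mvar.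
by apply: sos_sum => j /andP[jV _]; apply: sos_sqr; apply: polyIn_mvar.
Qed.

End SphereCone.

(** * Bernstein coefficients in one variable *)

(** Factorial moments of the binomial distribution: they express the power
    [u^j] in the Bernstein basis of any degree [N >= j] exactly, with
    coefficients that visibly converge to [(t/N)^j]. *)
Lemma sum_bin_ffact (A : comRingType) (u : A) N j :
  \sum_(t < N.+1) ('C(N, t) * t ^_ j)%:R * (u ^+ t * (1 - u) ^+ (N - t))
  = (N ^_ j)%:R * u ^+ j.
Proof.
elim: j N => [|j IH] N.
  rewrite expr0 mulr1 ffactn0; transitivity ((1 - u + u) ^+ N).
    rewrite exprDn; apply: eq_bigr => t _.
    by rewrite ffactn0 muln1 mulr_natl [X in X *+ _]mulrC.
  by rewrite subrK expr1n.
case: N => [|N].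
  by rewrite big_ord_recl big_ord0 /= ffact0n muln0 mul0r addr0 mul0r.
rewrite big_ord_recl /= ffact0n muln0 mul0r add0r ffactSS natrM exprS.
transitivity (N.+1%:R * u *
   \sum_(t < N.+1) ('C(N, t) * t ^_ j)%:R * (u ^+ t * (1 - u) ^+ (N - t))).
  rewrite mulr_sumr; apply: eq_bigr => t _; rewrite /bump /= add1n subSS ffactSS.
  rewrite mulnA [('C(_, _) * _)%N]mulnC -mul_bin_diag -mulnA natrM exprS /=; ring.
by rewrite IH; ring.
Qed.

Section UniformlyNear.
Variables (R : realType).

(** Uniform convergence to zero of [a N - b N], where the domain [T N] (a grid
    of mesh [1/N]) varies with [N]. *)
Definition unear (T : nat -> Type) (a b : forall N, T N -> R) :=
  forall e : R, 0 < e ->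
    exists N0, forall N, (N0 <= N)%N -> forall t, `|a N t - b N t| <= e.

Lemma unearD T (a b a' b' : forall N, T N -> R) : unear a b -> unear a' b' ->
  unear (fun N t => a N t + a' N t) (fun N t => b N t + b' N t).
Proof.
move=> ab ab' e e0; have e2 : 0 < e / 2 by rewrite divr_gt0.
have [N1 H1] := ab _ e2; have [N2 H2] := ab' _ e2.
exists (maxn N1 N2) => N; rewrite geq_max => /andP[/H1 {}H1 /H2 {}H2] t.
rewrite opprD addrACA (le_trans (ler_normD _ _))// [leRHS](splitr e).
exact: lerD.
Qed.

Lemma unear_sum T (I : Type) (r : seq I) (a b : I -> forall N, T N -> R) :
  (forall i, unear (a i) (b i)) ->
  unear (fun N t => \sum_(i <- r) a i N t) (fun N t => \sum_(i <- r) b i N t).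
Proof.
move=> ab; elim: r => [|i r IH].
  by move=> e e0; exists 0%N => N _ t; rewrite !big_nil subrr normr0 ltW.
move=> e e0; have [N0 H] := unearD (ab i) IH e0.
by exists N0 => N NN t; rewrite !big_cons; apply: H.
Qed.

Lemma unearM T (a b a' b' : forall N, T N -> R) :
  (forall N t, `|b N t| <= 1) -> (forall N t, `|b' N t| <= 1) ->
  unear a b -> unear a' b' ->
  unear (fun N t => a N t * a' N t) (fun N t => b N t * b' N t).
Proof.
move=> b1 b1' ab ab' e e0.
pose d := Num.min 1 (e / 3).
have d0 : 0 < d by rewrite lt_min ltr01 divr_gt0.
have [d1 de] : d <= 1 /\ d <= e / 3 by split; rewrite ge_min lexx ?orbT.
have [N1 H1] := ab _ d0; have [N2 H2] := ab' _ d0.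
exists (maxn N1 N2) => N; rewrite geq_max => /andP[/H1 {}H1 /H2 {}H2] t.
have -> : a N t * a' N t - b N t * b' N t
  = (a N t - b N t) * ((a' N t - b' N t) + b' N t) + b N t * (a' N t - b' N t).
  by ring.
have h1 : `|(a N t - b N t) * (a' N t - b' N t + b' N t)| <= d * 2.
  rewrite normrM ler_pM // (le_trans (ler_normD _ _))//.
  by rewrite [leRHS](_ : 2 = 1 + 1) ?lerD// (le_trans (H2 t)).
have h2 : `|b N t * (a' N t - b' N t)| <= 1 * d by rewrite normrM ler_pM.
by rewrite (le_trans (ler_normD _ _))//; lra.
Qed.

Lemma unearZ T c (a b : forall N, T N -> R) : unear a b ->
  unear (fun N t => c * a N t) (fun N t => c * b N t).
Proof.
move=> ab e e0; have c0 : 0 < `|c| + 1 by rewrite ltr_wpDl.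
have [N0 H] := ab _ (divr_gt0 e0 c0); exists N0 => N NN t.
rewrite -mulrBr normrM (le_trans (ler_wpM2l (normr_ge0 _) (H N NN t)))//.
by rewrite mulrCA ler_piMr ?(ltW e0)// ler_pdivrMr// mul1r lerDl.
Qed.

Lemma unear_prod T (I : Type) (r : seq I) (a b : I -> forall N, T N -> R) :
  (forall i N t, `|b i N t| <= 1) -> (forall i, unear (a i) (b i)) ->
  unear (fun N t => \prod_(i <- r) a i N t) (fun N t => \prod_(i <- r) b i N t).
Proof.
move=> b1 ab; elim: r => [|i r IH].
  by move=> e e0; exists 0%N => N _ t; rewrite !big_nil subrr normr0 ltW.
have P1 N t : `|\prod_(j <- r) b j N t| <= 1.
  by rewrite normr_prod; apply: prodr_ile1 => j _; rewrite normr_ge0 b1.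
move=> e e0; have [N0 H] := unearM (b1 i) P1 (ab i) IH e0.
by exists N0 => N NN t; rewrite !big_cons; apply: H.
Qed.

End UniformlyNear.

Section Bernstein.
Variables (R : realType).

Definition ffrac N j (t : 'I_N.+1) : R := (t ^_ j)%:R / (N ^_ j)%:R.

(** The factors [(t - i) / (N - i)] of the quotient of falling factorials are
    each within [i / N] of [t / N]. *)
Lemma ffrac_near j :
  unear (fun N => @ffrac N j) (fun N (t : 'I_N.+1) => (t%:R / N%:R) ^+ j).
Proof.
have r1 N (t : 'I_N.+1) : `|t%:R / N%:R| <= 1 :> R.
  rewrite ger0_norm ?divr_ge0//; case: N t => [t|N t]; first by rewrite invr0 mulr0.
  by rewrite ler_pdivrMr ?ltr0n// mul1r ler_nat -ltnS.
elim: j => [|j IH].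
  move=> e e0; exists 0%N => N _ t.
  by rewrite /ffrac !ffactn0 expr0 divr1 subrr normr0 ltW.
have F : unear (fun N (t : 'I_N.+1) => (t - j)%:R / (N - j)%:R : R)
               (fun N (t : 'I_N.+1) => t%:R / N%:R : R).
  move=> e e0.
  have [K jK] : exists K, j%:R / e <= K%:R.
    by exists (Num.bound (j%:R / e)); rewrite ltW// archi_boundP// divr_ge0// ltW.
  exists (maxn K j.+1) => N; rewrite geq_max => /andP[KN jN] t.
  have N0 : 0 < N%:R :> R by rewrite ltr0n (leq_trans _ jN).
  have jNe : j%:R / N%:R <= e.
    rewrite ler_pdivrMr// mulrC -ler_pdivrMr// (le_trans jK)// ler_nat //.
  have tN : t%:R <= N%:R :> R by rewrite ler_nat -ltnS.
  (* The truncated difference t - j vanishes, and t / N is itself small. *)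
  have [jt|tj] := leqP j t; last first.
    rewrite (eqP (ltnW tj : (t - j)%N == 0%N)) mul0r sub0r normrN.
    rewrite ger0_norm ?divr_ge0// (le_trans _ jNe)// ler_pM2r ?invr_gt0//.
    by rewrite ler_nat ltnW.
  rewrite !natrB ?(ltnW jN)//.
  have jt' : j%:R <= t%:R :> R by rewrite ler_nat.
  have j0 : 0 <= j%:R :> R by [].
  have NJ : 0 < N%:R - j%:R :> R by rewrite subr_gt0 ltr_nat.
  rewrite distrC ler_norml; apply/andP; split.
    rewrite (le_trans (y := 0)) ?oppr_le0 ?(ltW e0)// subr_ge0 ler_pdivrMr//.
    by rewrite mulrAC ler_pdivlMr//; nra.
  rewrite (le_trans _ jNe)// lerBlDr -lerBlDl -mulrBl ler_wpM2l ?subr_ge0//.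
  by rewrite lef_pV2 ?posrE// gerBl.
move=> e e0.
have X1 N (t : 'I_N.+1) : `|(t%:R / N%:R) ^+ j| <= 1 :> R.
  by rewrite normrX exprn_ile1.
have [N0 H] := unearM X1 r1 IH F e0.
exists N0 => N NN t; have := H N NN t.
by rewrite /ffrac !ffactnSr !natrM invfM exprSr mulrACA.
Qed.


Definition node N (t : 'I_N.+1) : R := 2 * (t%:R / N%:R) - 1.

(** The binomial expansion of [x^j = (2 u - 1)^j] with [u^i] replaced by its
    coefficient in the Bernstein basis of degree [N]. *)
Definition power_coef j N (t : 'I_N.+1) : R :=
  \sum_(i < j.+1) ((-1) ^+ (j - i) * 2 ^+ i *+ 'C(j, i)) * ffrac i t.

Lemma power_coef0 N (t : 'I_N.+1) : power_coef 0 t = 1.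
Proof.
by rewrite /power_coef big_ord1 /ffrac !ffactn0 divr1 mulr1 subnn !expr0 mulr1.
Qed.

Lemma power_coef_near j :
  unear (@power_coef j) (fun N (t : 'I_N.+1) => node t ^+ j).
Proof.
move=> e e0.
have [N0 H] := unear_sum (index_enum 'I_j.+1)
   (fun i => unearZ ((-1) ^+ (j - i) * 2 ^+ i *+ 'C(j, i)) (ffrac_near i)) e0.
exists N0 => N NN t; have := H N NN t; congr (`|_ - _| <= _).
rewrite /node addrC exprDn. apply: eq_bigr => i _.
by move: (t%:R / _) => x; rewrite exprMn mulrnAl mulrA.
Qed.

Lemma node_le1 N (t : 'I_N.+1) : `|node t| <= 1.
Proof.
have : 0 <= (t%:R / N%:R : R) <= 1.
  rewrite divr_ge0//=; case: N t => [t|N t]; first by rewrite invr0 mulr0.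
  by rewrite ler_pdivrMr ?ltr0n// mul1r ler_nat -ltnS.
by rewrite /node ler_norml => /andP[? ?]; apply/andP; split; lra.
Qed.

Variables (n : nat).

(** The Bernstein basis of [-1, 1], in the coordinate [u = (1 + x_i) / 2]. *)
Definition bern N (i : 'I_n) (t : 'I_N.+1) : {mpoly R[n]} :=
  'C(N, t)%:R *: ((2^-1 *: (1 + mvar R i)) ^+ t *
                  (2^-1 *: (1 - mvar R i)) ^+ (N - t)).

Lemma bern_power N i j : (j <= N)%N ->
  mvar R i ^+ j = \sum_(t < N.+1) power_coef j t *: bern i t.
Proof.
move=> jN; pose u := 2^-1 *: (1 + mvar R i).
have two : 2 != 0 :> R by rewrite pnatr_eq0.
have uE : 2^-1 *: (1 - mvar R i) = 1 - u.
  apply: (scalerI two); rewrite scalerA divff// [RHS]scalerBr /u scalerA divff// !scale1r.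
  by rewrite scaler_nat mulr2n; ring.
have uj k : (k <= N)%N -> u ^+ k = \sum_(t < N.+1) ffrac k t *: bern i t.
  move=> kN; have Nk : (N ^_ k)%:R != 0 :> R.
    by rewrite pnatr_eq0 -lt0n ffact_gt0.
  apply: (scalerI Nk); rewrite scaler_nat -[LHS]mulr_natl -sum_bin_ffact scaler_sumr.
  apply: eq_bigr => t _; rewrite /bern uE -/u /ffrac !scalerA.
  rewrite [X in _ = X *: _](_ : _ = ('C(N, t) * t ^_ k)%:R).
    by rewrite scaler_nat mulr_natl.
  by rewrite natrM; field.
have xu : mvar R i = 2 *: u - 1.
  by rewrite scalerA divff// scale1r addrC addKr.
clearbody u.
transitivity (\sum_(k < j.+1) ((-1) ^+ (j - k) * 2 ^+ k *+ 'C(j, k)) *: u ^+ k).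
  rewrite [in LHS]xu addrC exprDn; apply: eq_bigr => k _.
  rewrite -[RHS]scalerMnl exprZn -scalerAr; congr (_ *+ _).
  rewrite [in RHS]mulrC -scalerA; congr (_ *: _).
  by rewrite -mul_mpolyC rmorphXn /= rmorphN1.
under eq_bigr => k _.
  rewrite uj; last by rewrite (leq_trans _ jN)// -ltnS.
  rewrite scaler_sumr.
  under eq_bigr do rewrite scalerA.
  over.
by rewrite exchange_big; apply: eq_bigr => t _; rewrite -scaler_suml.
Qed.

Lemma sum_bern N i : \sum_(t < N.+1) bern i t = 1.
Proof.
rewrite -(expr0 (mvar R i)) (bern_power i (leq0n N)).
by apply: eq_bigr => t _; rewrite power_coef0 scale1r.
Qed.

End Bernstein.

(** * Tensor Bernstein coefficients *)

Definition depends_on (R : realType) (I T : finType) (V : {set I}) (c : {ffun I -> T} -> R) :=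
  forall k k' : {ffun I -> T}, {in V, k =1 k'} -> c k = c k'.

Section Grid.
Variables (R : realType) (n : nat).
Implicit Types (N : nat) (V : {set 'I_n}).

Definition grid_bern N (k : {ffun 'I_n -> 'I_N.+1}) : {mpoly R[n]} :=
  \prod_i bern R i (k i).

Definition grid_node N (k : {ffun 'I_n -> 'I_N.+1}) (i : 'I_n) : R := node R (k i).

Definition grid_coef (q : {mpoly R[n]}) N (k : {ffun 'I_n -> 'I_N.+1}) : R :=
  \sum_(m <- msupp q) mcoeff m q * \prod_i power_coef R (m i) (k i).

Lemma grid_coefE (q : {mpoly R[n]}) N : (msize q <= N)%N ->
  q = \sum_(k : {ffun 'I_n -> 'I_N.+1}) grid_coef q k *: grid_bern k.
Proof.
move=> qN; rewrite [LHS]mpolyE.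
under [RHS]eq_bigr do rewrite scaler_suml.
rewrite [RHS]exchange_big; apply: eq_big_seq => m mq /=.
under [RHS]eq_bigr do rewrite -scalerA.
rewrite -scaler_sumr; congr (_ *: _).
rewrite mpolyXE_id; under eq_bigr => i _.
  rewrite (@bern_power R n N).
    over.
  rewrite (leq_trans _ qN)// ltnW// (leq_ltn_trans _ (msize_mdeg_lt mq))//.
  by rewrite mdegE (bigD1 i)//= leq_addr.
rewrite bigA_distr_bigA; apply: eq_bigr => k _.
by rewrite scaler_prod.
Qed.

Lemma grid_coef_near (q : {mpoly R[n]}) :
  unear (@grid_coef q) (fun N k => meval (@grid_node N k) q).
Proof.
move=> e e0.
have H0 (m : multinom n) : unear
    (fun N (k : {ffun 'I_n -> 'I_N.+1}) => \prod_i power_coef R (m i) (k i))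
    (fun N (k : {ffun 'I_n -> 'I_N.+1}) => \prod_i grid_node k i ^+ (m i)).
  apply: unear_prod => [i N k|i d d0].
    by rewrite normrX exprn_ile1// node_le1.
  have [N0 H] := power_coef_near (m i) d0.
  by exists N0 => N NN k; apply: H.
have [N0 H] := unear_sum (msupp q) (fun m => unearZ (mcoeff m q) (H0 m)) e0.
by exists N0 => N NN k; rewrite mevalE; apply: H.
Qed.

Lemma grid_coef_depends V (q : {mpoly R[n]}) N : polyIn V q ->
  depends_on V (@grid_coef q N).
Proof.
move=> /polyInP Vq k k' kk'; apply: eq_big_seq => m mq; congr (_ * _).
apply: eq_bigr => i _; have [/kk' ->//|/(Vq _ mq) ->] := boolP (i \in V).
by rewrite !power_coef0.
Qed.

(** The coordinates outside [V] are summed out because the univariate Bernstein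
    polynomials form a partition of unity; what is left involves the variables
    in [V] only. *)
Lemma sum_grid_bern V N (c : {ffun 'I_n -> 'I_N.+1} -> R) : depends_on V c ->
  \sum_k c k *: grid_bern k =
  \sum_(k : {ffun 'I_n -> 'I_N.+1} | [forall (i | i \notin V), k i == ord0])
     c k *: \prod_(i in V) bern R i (k i).
Proof.
move=> Vc.
pose pr (k : {ffun 'I_n -> 'I_N.+1}) : {ffun 'I_n -> 'I_N.+1} :=
  [ffun i => if i \in V then k i else ord0].
rewrite (partition_big pr
  (fun k : {ffun 'I_n -> 'I_N.+1} => [forall (i | i \notin V), k i == ord0])) /=; last first.
  move=> k _; by apply/forall_inP => i iV; rewrite ffunE (negbTE iV).
apply: eq_bigr => k /forall_inP k0.
pose Q i : pred 'I_N.+1 := fun t => (i \in V) ==> (t == k i).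
have -> : \prod_(i in V) bern R i (k i) = \prod_i \sum_(t | Q i t) bern R i t.
  rewrite [RHS](bigID (fun i => i \in V)) /= [X in _ * X]big1 ?mulr1.
    apply: eq_bigr => i iV; rewrite (big_pred1 (k i))// => t.
    by rewrite /Q iV.
  move=> i iV; rewrite -[RHS](sum_bern R N i); apply: eq_bigl => t.
  by rewrite /Q (negbTE iV).
rewrite bigA_distr_big_dep scaler_sumr; apply: eq_big => [k'|k' /eqP kk'].
  apply/eqP/familyP => [kk' i|H].
    by rewrite unfold_in /Q -kk' ffunE; apply/implyP => ->.
  apply/ffunP => i; rewrite ffunE; case: ifPn => iV; last first.
    by rewrite (eqP (k0 i iV)).
  by have := H i; rewrite unfold_in /Q iV => /eqP.
by congr (_ *: _); apply: Vc => i iV; rewrite -kk' ffunE iV.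
Qed.

(** Every factor of a Bernstein polynomial is a multiple of a power of [1 + x]
    or [1 - x], which the equation of the sphere makes a sum of squares. *)
Lemma sosSphere_grid V N (c : {ffun 'I_n -> 'I_N.+1} -> R) :
  depends_on V c -> (forall k, 0 <= c k) ->
  sosSphere V (\sum_k c k *: grid_bern k).
Proof.
move=> Vc c0; rewrite (sum_grid_bern Vc).
apply: sosSphere_sum => k _; apply: sosSphereZ => //.
apply: sosSphere_prod => i iV.
apply: sosSphereZ; first by [].
apply: sosSphereM; apply: sosSphereX; apply: sosSphereZ; rewrite ?invr_ge0//.
  by rewrite -[mvar R i]scale1r; apply: sosSphere_coord => //; rewrite expr1n.
by rewrite -scaleN1r; apply: sosSphere_coord => //; rewrite sqrrN expr1n.
Qed.

End Grid.

(** * Splitting along the running intersection property *)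

(** By induction on the number [q] of blocks. If [phi] is the minimum of the
    last summand over all points with given values on its intersection [W] with
    the earlier blocks, then subtracting [phi] leaves a nonnegative function,
    and adding it to a block containing [W] keeps the earlier blocks' sum
    nonnegative: at each point that sum equals the full original sum at a point
    where the last summand attains its minimum. *)
Lemma rip_redistribute (R : realType) (n p : nat) (T : finType)
    (V : 'I_p -> {set 'I_n}) (c : 'I_p -> {ffun 'I_n -> T} -> R) :
  RIP V -> (forall l, depends_on (V l) (c l)) ->
  (forall k, 0 <= \sum_l c l k) ->
  exists c', [/\ forall l, depends_on (V l) (c' l), forall l k, 0 <= c' l k
               & forall k, \sum_l c' l k = \sum_l c l k].
Proof.
move=> rip dc c0.
suff /(_ p (leqnn _) c dc) [|c' [dc' c0' sc']] : forall q, (q <= p)%N ->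
  forall c : 'I_p -> {ffun 'I_n -> T} -> R, (forall l, depends_on (V l) (c l)) ->
  (forall k, 0 <= \sum_(l < p | (l < q)%N) c l k) ->
  exists c', [/\ forall l, depends_on (V l) (c' l),
                 forall (l : 'I_p) k, (l < q)%N -> 0 <= c' l k
   & forall k, \sum_(l < p | (l < q)%N) c' l k = \sum_(l < p | (l < q)%N) c l k].
- by move=> k; under eq_bigl do rewrite ltn_ord.
- exists c'; split=> // [l k|k]; first exact: c0'.
  have := sc' k; under eq_bigl do rewrite ltn_ord.
  by under [X in _ = X -> _]eq_bigl do rewrite ltn_ord.
elim=> [|q IH] qp {dc c0}c dc c0; first by exists c.
pose a := Ordinal qp.
have S (F : 'I_p -> R) :
    \sum_(l < p | (l < q.+1)%N) F l = F a + \sum_(l < p | (l < q)%N) F l.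
  rewrite (bigD1 a) ?ltnSn//=; congr (_ + _); apply: eq_bigl => l.
  by rewrite ltnS ltn_neqAle andbC.
have [q0|q0] := posnP q.
  exists c; split=> // l k lq; have := c0 k; rewrite S big1 ?addr0; last first.
    by move=> i; rewrite q0.
  suff -> : l = a by [].
  by apply: val_inj => /=; move: lq; rewrite q0; case: (nat_of_ord l).
have [s sa Ws] := rip a q0.
pose U := (\bigcup_(j < p | (j < a)%N) V j)%SET.
pose W := V a :&: U.
pose agree (k k' : {ffun 'I_n -> T}) := [forall (i | i \in W), k' i == k i].
have agreeP (k k' : {ffun 'I_n -> T}) : reflect {in W, k' =1 k} (agree k k').
  by apply: (iffP forall_inP) => H i iW; apply/eqP; rewrite ?H//; apply/eqP/H.
have agr k : agree k k by apply/agreeP.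
pose mk (k : {ffun 'I_n -> T}) := [arg min_(k' < k | agree k k') c a k']%O.
pose phi (k : {ffun 'I_n -> T}) := c a (mk k).
have phiP k : [/\ agree k (mk k) & forall k', agree k k' -> phi k <= c a k'].
  by rewrite /phi /mk; case: arg_minP => // k' ? ?.
have dphi : depends_on W phi.
  have le (k k' : {ffun 'I_n -> T}) : {in W, k =1 k'} -> phi k <= phi k'.
    move=> kk'; apply: (phiP k).2; have [/agreeP H _] := phiP k'.
    by apply/agreeP => i iW; rewrite H// kk'.
  by move=> k k' kk'; apply/le_anti; rewrite !le// => i iW; rewrite kk'.
pose c1 (l : 'I_p) (k : {ffun 'I_n -> T}) := if l == s then c l k + phi k else c l k.
have dc1 l : depends_on (V l) (c1 l).
  move=> k k' kk'; rewrite /c1; case: eqP => [ls|_]; last exact: dc.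
  rewrite (dc l k k')//; congr (_ + _); apply: dphi => i iW.
  by apply: kk'; rewrite ls; apply: (fintype.subsetP Ws).
have sc1 k : \sum_(l < p | (l < q)%N) c1 l k
             = phi k + \sum_(l < p | (l < q)%N) c l k.
  rewrite (bigD1 s)//= [in RHS](bigD1 s)//= /c1 eqxx addrCA addrA.
  by congr (_ + _); apply: eq_bigr => l /andP[_ /negbTE->].
have [|c1' [d1' p1' s1']] := IH (ltnW qp) c1 dc1.
  move=> k; rewrite sc1.
  (* Shared coordinates from k, the private ones of the last block from the
     minimiser. *)
  pose k2 : {ffun 'I_n -> T} := [ffun i => if i \in U then k i else mk k i].
  have := c0 k2; rewrite S.
  have -> : c a k2 = phi k.
    apply: dc => i iV; rewrite ffunE; case: ifPn => // iU.
    by have [/agreeP -> //] := phiP k; rewrite inE iV.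
  congr (_ <= _ + _); apply: eq_bigr => l lq; apply: dc => i iV.
  by rewrite ffunE ifT//; apply/bigcupP; exists l.
exists (fun l k => if l == a then c a k - phi k else c1' l k); split.
- move=> l k k' kk'; case: eqP => [la|_]; last exact: d1'.
  rewrite (dc a k k') -?la//; congr (_ - _); apply: dphi => i.
  by rewrite inE -la => /andP[/kk'].
- move=> l k lq; case: eqP => [_|/eqP la].
    by rewrite subr_ge0; apply: (phiP k).2.
  by apply: p1'; rewrite ltn_neqAle -ltnS lq andbT.
- move=> k; rewrite !S eqxx.
  transitivity (c a k - phi k + \sum_(l < p | (l < q)%N) c1' l k).
    congr (_ + _); apply: eq_bigr => l lq; case: eqP => // la.
    by rewrite la ltnn in lq.
  by rewrite s1' sc1; ring.
Qed.

(** For large [N] the total Bernstein coefficients are within [e] of values that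
    are at least [e], hence nonnegative, and can be split block by block. *)
Lemma box_positive_sosSphere (R : realType) (n p : nat) (V : 'I_p -> {set 'I_n})
    (F : 'I_p -> {mpoly R[n]}) (e : R) :
  RIP V -> (forall l, polyIn (V l) (F l)) -> 0 < e ->
  (forall x : 'I_n -> R, (forall i, `|x i| <= 1) -> e <= meval x (\sum_l F l)) ->
  exists2 t : 'I_p -> {mpoly R[n]},
    (forall l, sosSphere (V l) (t l)) & \sum_l F l = \sum_l t l.
Proof.
move=> rip VF e0 Fe.
have [N0 HN] := unear_sum (index_enum 'I_p) (fun l => grid_coef_near (F l)) e0.
pose N := maxn N0 (\max_l msize (F l)).
have [c' [dc' c0' sc']] : exists c' : 'I_p -> {ffun 'I_n -> 'I_N.+1} -> R,
    [/\ forall l, depends_on (V l) (c' l), forall l k, 0 <= c' l k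
      & forall k, \sum_l c' l k = \sum_l grid_coef (F l) k].
  apply: rip_redistribute => // [l|k]; first exact/grid_coef_depends.
  have := HN N (leq_maxl _ _) k; rewrite ler_norml => /andP[+ _].
  have : e <= \sum_l meval (grid_node R k) (F l).
    rewrite -raddf_sum; apply: Fe => i; exact: node_le1.
  by move=> h1 h2; rewrite -(lerD2r (- e)) add0r (le_trans h2)// lerD2l lerN2.
exists (fun l => \sum_k c' l k *: grid_bern R k).
  by move=> l; apply: sosSphere_grid.
transitivity (\sum_l \sum_(k : {ffun 'I_n -> 'I_N.+1}) grid_coef (F l) k *: grid_bern R k).
  apply: eq_bigr => l _; apply: grid_coefE.
  by rewrite (leq_trans _ (leq_maxr _ _))// (leq_bigmax l).
rewrite exchange_big [RHS]exchange_big; apply: eq_bigr => k _ /=.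
by rewrite -!scaler_suml sc'.
Qed.

(** * Penalties *)

Lemma meval_continuous (R : realType) n (q : {mpoly R[n]}) :
  continuous (fun z : 'rV[R]_n => meval (z 0) q).
Proof.
rewrite (_ : (fun z => _) = fun z : 'rV[R]_n =>
   \sum_(m <- msupp q) mcoeff m q * \prod_i z 0 i ^+ m i); last first.
  by apply/funext => z; rewrite mevalE.
apply: continuous_big => [z|m _]; first exact: add_continuous.
have cP : continuous (fun z : 'rV[R]_n => \prod_i z 0 i ^+ (m i)).
  apply: continuous_big => [x|i _]; first exact: mul_continuous.
  move=> x; apply: (@cvg_comp _ _ _ (fun z : 'rV[R]_n => z 0 i) (fun t => t ^+ m i)).
    exact: coord_continuous.
  exact: exprn_continuous.
by move=> z; apply: cvgM (cvg_cst _) (cP z).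
Qed.

Section Penalty.
Variables (R : realType).

(** Where [f <= 0] the violation [v] is bounded away from 0 by compactness, so a
    large multiple of it outweighs the minimum of [f]. *)
Lemma exact_penalty (T : topologicalType) (C : set T) (f v : T -> R) :
  compact C -> continuous f -> continuous v -> (forall z, 0 <= v z) ->
  (forall z, C z -> v z = 0 -> 0 < f z) ->
  exists mu e, [/\ 0 <= mu, 0 < e & forall z, C z -> e <= f z + mu * v z].
Proof.
move=> cC cf cv v0 fpos.
have min (A : set T) (w : T -> R) : compact A -> continuous w ->
    (exists z, A z) -> exists2 c, A c & forall z, A z -> w c <= w z.
  move=> cA cw A0; have [|c cAw H] := @compact_EVT_min T R w A A0 cA.
    exact: continuous_subspaceT.
  by exists c => [|z Az]; [rewrite inE in cAw|apply: H; rewrite inE].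
have [C0|C0] := pselect (exists z, C z); last first.
  by exists 0, 1; split=> // z Cz; case: C0; exists z.
suff [mu mu0 H] : exists2 mu, 0 <= mu & forall z, C z -> 0 < f z + mu * v z.
  have [|c Cc Hc] := min C (fun z => f z + mu * v z) cC _ C0.
    by move=> z; apply: cvgD (cf z) (cvgM (cvg_cst _) (cv z)).
  by exists mu, (f c + mu * v c); split=> //; exact: H.
pose C' := C `&` [set z | f z <= 0].
have cC' : compact C'.
  apply: compact_closedI => //.
  rewrite (_ : [set z | _] = f @^-1` [set x | x <= 0])//.
  by apply: preimage_closed; [move=> z _; exact: cf|exact: closed_le].
have [C'0|C'0] := pselect (exists z, C' z); last first.
  exists 0 => // z Cz; rewrite mul0r addr0 ltNge; apply/negP => fz.
  by apply: C'0; exists z.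
have [c [Cc fc] Hc] := min C' v cC' cv C'0.
have [b Cb Hb] := min C f cC cf C0.
have vc : 0 < v c.
  by rewrite lt_neqAle v0 andbT eq_sym; apply/eqP => /(fpos _ Cc); rewrite ltNge fc.
exists ((`|f b| + 1) / v c) => [|z Cz]; first by rewrite divr_ge0// ?addr_ge0// ltW.
have [fz|fz] := ltP 0 (f z).
  by rewrite ltr_pwDl// mulr_ge0// divr_ge0// ?addr_ge0// ltW.
have : (`|f b| + 1) / v c * v c <= (`|f b| + 1) / v c * v z.
  by apply: ler_wpM2l; [rewrite divr_ge0// ?addr_ge0// ltW|apply: Hc].
rewrite divfK ?gt_eqF// => h.
have := Hb z Cz; have := ler_norm (- f b); rewrite normrN => h1 h2.
lra.
Qed.

Lemma bernoulli_ineq (x : R) N : -1 <= x -> 1 + N%:R * x <= (1 + x) ^+ N.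
Proof.
move=> x1; elim: N => [|N IH]; first by rewrite mul0r addr0 expr0.
have h : 0 <= 1 + x by lra.
rewrite exprSr (le_trans _ (ler_wpM2r h IH))// -natr1.
have := ler0n R N; nra.
Qed.

(** The polynomial [t (1 - t)^(2k)] is at most [1 / (2k)] on [0, 1], and its
    absolute value grows geometrically in [k] at each [t < 0]; both bounds are
    instances of Bernoulli's inequality. *)
Lemma hinge_approx (mu e : R) : 0 <= mu -> 0 < e ->
  exists k, forall t, `|t| <= 1 ->
    mu * Num.max 0 (- t) - e <= - (t * (1 - t) ^+ (2 * k)).
Proof.
move=> mu0 e0.
(* Any exponent N with N e >= 1 and N e >= mu^2 will do. *)
pose a := (1 + mu ^+ 2) / e.
have a0 : 0 <= a by rewrite divr_ge0// ?addr_ge0 ?sqr_ge0// ltW.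
have ak := ltW (archi_boundP a0); set k := Num.bound a in ak.
exists k => t; rewrite ler_norml => /andP[t1 t2].
pose N := (2 * k)%N; rewrite -/N.
have aN : 1 + mu ^+ 2 <= N%:R * e.
  rewrite -ler_pdivrMr// (le_trans ak)// ler_nat /N; lia.
have [t0|t0] := leP 0 t.
  rewrite (_ : Num.max _ _ = 0); last by apply/max_idPl; rewrite oppr_le0.
  rewrite mulr0 sub0r lerN2.
  have q0 : 0 <= (1 - t) ^+ N by rewrite exprn_ge0// subr_ge0.
  have : (1 + N%:R * t) * (1 - t) ^+ N <= 1.
    rewrite (le_trans (ler_wpM2r q0 (bernoulli_ineq N t1)))// -exprMn.
    have t0' : 0 <= 1 - t by lra.
    apply: exprn_ile1; last first.
      by nra.
    by rewrite mulr_ge0// addr_ge0.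
  have N0 : 0 < N%:R :> R.
    by rewrite -(pmulr_lgt0 _ e0) (lt_le_trans _ aN)// ltr_pwDl ?sqr_ge0.
  rewrite mulrDl mul1r -mulrA => h1; rewrite -(ler_pM2l N0).
  have := sqr_ge0 mu; lra.
rewrite (_ : Num.max _ _ = - t); last by apply/max_idPr; rewrite oppr_ge0 ltW.
have [s s0 ->] : exists2 s, 0 < s & t = - s by exists (- t); rewrite ?opprK// oppr_gt0.
rewrite !opprK mulNr opprK.
have [mus|mus] := leP (mu * s) e.
  rewrite (le_trans (y := 0)) ?subr_le0// mulr_ge0 ?(ltW s0)// exprn_ge0//.
  by rewrite addr_ge0// ltW.
have := @bernoulli_ineq s N; rewrite (le_trans (y := 0)) ?(ltW s0)// ?oppr_le0// => /(_ isT) h.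
have h2 : mu <= (1 + s) ^+ N.
  rewrite (le_trans _ h)//.
  have mup : 0 < mu by rewrite -(pmulr_lgt0 _ s0) (lt_trans e0).
  rewrite -(ler_pM2l mup).
  have : N%:R * e <= N%:R * (mu * s) by rewrite ler_wpM2l// ltW.
  nra.
have := ler_wpM2l (ltW s0) h2; lra.
Qed.

Lemma square_approx (mu e x : R) : 0 < e ->
  mu * `|x| - e <= mu ^+ 2 / (4 * e) * x ^+ 2.
Proof.
move=> e0; rewrite -(real_normK (num_real x)).
have : 0 <= (mu * `|x| - 2 * e) ^+ 2 / (4 * e).
  by rewrite divr_ge0 ?sqr_ge0// mulr_ge0// ltW.
rewrite (_ : _ / _ = mu ^+ 2 / (4 * e) * `|x| ^+ 2 - mu * `|x| + e); first lra.
by field; rewrite gt_eqF.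
Qed.

Lemma meval_box_bound n (q : {mpoly R[n]}) (x : 'I_n -> R) :
  (forall i, `|x i| <= 1) ->
  `|meval x q| <= \sum_(m <- msupp q) `|mcoeff m q|.
Proof.
move=> x1; rewrite mevalE (le_trans (ler_norm_sum _ _ _))//.
apply: ler_sum => m _; rewrite normrM ler_piMr// normr_prod.
by apply: prodr_ile1 => i _; rewrite normr_ge0 normrX exprn_ile1.
Qed.

End Penalty.

(** * A sparse Positivstellensatz for products of spheres *)

Section SparsePutinar.
Variables (R : realType) (n p : nat) (V : 'I_p -> {set 'I_n}).
Variables (G : 'I_p -> seq {mpoly R[n]}) (F : 'I_p -> {mpoly R[n]}).

(** The multiplier [sigma] is a function of the constraint polynomial alone: the
    penalty weight [mu], the scaling [M] and the exponent [k] are common to all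
    constraints and blocks. *)
Lemma sparse_putinar :
  RIP V -> (forall l, polyIn (V l) (F l)) ->
  (forall l g, g \in G l -> polyIn (V l) g) ->
  (forall z : 'rV[R]_n, (forall l, meval (z 0) (sphere_poly R (V l)) = 0) ->
     (forall l g, g \in G l -> 0 <= meval (z 0) g) ->
     0 < meval (z 0) (\sum_l F l)) ->
  exists r s sigma,
    [/\ forall l, polyIn (V l) (r l), forall l, sos (V l) (s l),
        forall l g, g \in G l -> sos (V l) (sigma g)
      & \sum_l F l = \sum_l (sphere_poly R (V l) * r l
                             + (s l + \sum_(g <- G l) g * sigma g))].
Proof.
move=> rip VF VG Fpos.
pose h l := sphere_poly R (V l).
pose viol (z : 'rV[R]_n) := \sum_l (`|meval (z 0) (h l)|
      + \sum_(g <- G l) Num.max 0 (- meval (z 0) g)).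
pose box := [set z : 'rV[R]_n | forall i, z ord0 i \in `[(-1), 1]].
have cbox : compact box.
  apply: (@rV_compact R n (fun=> `[(-1), 1]%classic)).
  by move=> _; apply: segment_compact.
have maxge0 (x : R) : 0 <= Num.max 0 x by rewrite le_max lexx.
have viol_ge0 z : 0 <= viol z.
  by apply: sumr_ge0 => l _; rewrite addr_ge0// sumr_ge0.
have cviol : continuous viol.
  apply: continuous_big => [x|l _]; first exact: add_continuous.
  have cG : continuous (fun z : 'rV[R]_n => \sum_(g <- G l) Num.max 0 (- meval (z 0) g)).
    apply: continuous_big => [x|g _]; first exact: add_continuous.
    move=> x; apply: (@continuous_max _ _ (fun=> 0)
      (fun z : 'rV[R]_n => - meval (z 0) g)); first exact: cst_continuous.
    exact: (cvgN (@meval_continuous _ _ g x)).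
  by move=> z; apply: cvgD (cvg_norm (@meval_continuous _ _ (h l) z)) (cG z).
have [|mu [e [mu0 e0 He]]] := exact_penalty cbox
    (meval_continuous (q := \sum_l F l)) cviol viol_ge0.
  move=> z _ /eqP; rewrite psumr_eq0; last first.
    by move=> l _; rewrite addr_ge0// sumr_ge0.
  move=> /allP z0.
  have {}z0 l : (`|meval (z 0) (h l)| == 0)
             && (\sum_(g <- G l) Num.max 0 (- meval (z 0) g) == 0).
    by rewrite -paddr_eq0 ?sumr_ge0//; have := z0 l (mem_index_enum l).
  apply: Fpos => [l|l g gG]; have /andP[hl] := z0 l.
    by move=> _; apply/eqP; rewrite -normr_eq0.
  rewrite psumr_eq0// => /allP /(_ g gG) /= /eqP gz.
  by rewrite -oppr_le0 -gz le_max lexx orbT.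
pose K := \sum_l (1 + \sum_(g <- G l) 1) : R.
have K0 : 0 <= K by apply: sumr_ge0 => l _; rewrite addr_ge0// sumr_ge0.
(* Each of the K penalty terms may lose d, in total at most e / 2. *)
pose d := e / (2 * (K + 1)).
have d0 : 0 < d by rewrite divr_gt0// mulr_gt0// ltr_wpDl.
have Kd : K * d <= e / 2.
  rewrite /d mulrA ler_pdivrMr; last by rewrite mulr_gt0// ltr_wpDl.
  rewrite (_ : e / 2 * _ = K * e + e) ?lerDl ?ltW//; by field.
pose B (g : {mpoly R[n]}) : R := \sum_(m <- msupp g) `|mcoeff m g|.
have B0 g : 0 <= B g by apply: sumr_ge0.
pose M := 1 + \sum_l \sum_(g <- G l) B g.
have M0 : 0 < M by rewrite ltr_pwDl// sumr_ge0// => l _; rewrite sumr_ge0.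
have BM l g : g \in G l -> B g <= M.
  move=> gG; rewrite /M (bigD1 l)//= (big_rem g)//= [leRHS]addrC -!addrA lerDl.
  by rewrite !addr_ge0// ?sumr_ge0// => l' _; rewrite sumr_ge0.
have [k Hk] := hinge_approx (mulr_ge0 mu0 (ltW M0)) d0.
pose sigma (g : {mpoly R[n]}) := M^-1 *: ((1 - M^-1 *: g) ^+ k) ^+ 2.
pose lam := mu ^+ 2 / (4 * d).
pose F' l := F l + lam *: h l ^+ 2 - \sum_(g <- G l) g * sigma g.
have Vsigma l g : g \in G l -> sos (V l) (sigma g).
  move=> gG; apply: sosZ; first by rewrite invr_ge0 ltW.
  apply/sos_sqr/polyInXn/polyInB; first exact: polyIn1.
  by apply: polyInZ; apply: VG gG.
have VF' l : polyIn (V l) (F' l).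
  apply: polyInB.
    apply: polyInD; first exact: VF.
    by apply/polyInZ/polyInXn/polyIn_sphere_poly.
  rewrite big_seq; apply: polyIn_sum => g gG; apply: polyInM; first exact: VG.
  exact/sos_polyIn/Vsigma.
have e2 : 0 < e / 2 by rewrite divr_gt0.
have [|t Vt Ft] := box_positive_sosSphere rip VF' e2.
  move=> x x1; pose z : 'rV[R]_n := \row_i x i.
  have zx : z 0 = x by apply/funext => i; rewrite mxE.
  have bz : box z.
    by move=> i; rewrite in_itv /= -ler_norml mxE.
  have := He z bz; rewrite zx.
  have hL l : mu * `|meval x (h l)| - d <= meval x (lam *: h l ^+ 2).
    by rewrite mevalZ rmorphXn /=; apply: square_approx.
  have gL l g : g \in G l ->
      mu * Num.max 0 (- meval x g) - d <= - meval x (g * sigma g).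
    move=> gG; have t1 : `|meval x g / M| <= 1.
      rewrite normrM normfV (gtr0_norm M0) ler_pdivrMr// mul1r.
      by rewrite (le_trans (meval_box_bound _ x1))// (BM l).
    have := Hk _ t1; rewrite -mulrA maxr_pMr ?(ltW M0)// mulr0 mulrN.
    rewrite mulrCA divff ?gt_eqF// mulr1 => /le_trans; apply.
    rewrite mevalM mevalZ !rmorphXn /= mevalB meval1 mevalZ.
    by rewrite -exprM [(k * 2)%N]mulnC mulrA [M^-1 * meval x g]mulrC.
  have -> : \sum_l F' l = \sum_l F l
      + \sum_l (lam *: h l ^+ 2 - \sum_(g <- G l) g * sigma g).
    by rewrite -big_split /=; apply: eq_bigr => l _; rewrite /F' addrA.
  rewrite mevalD.
  suff : mu * viol z - K * d <= meval x (\sum_l (lam *: h l ^+ 2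
           - \sum_(g <- G l) g * sigma g)) by lra.
  rewrite [leRHS]raddf_sum /=; under [leRHS]eq_bigr do rewrite mevalB (raddf_sum (meval x)) /=.
  rewrite /viol /K mulr_sumr mulr_suml -sumrB; apply: ler_sum => l _.
  rewrite mulrDr mulrDl mul1r opprD addrACA zx lerD ?hL//.
  rewrite mulr_sumr mulr_suml -sumrB -sumrN !big_seq; apply: ler_sum => g gG.
  by rewrite mul1r (gL l).
have [s Hs] := choice Vt; have [r Hr] := choice Hs.
exists (fun l => r l - lam *: h l), s, sigma; split=> //.
- move=> l; have [_ ? _] := Hr l; apply: polyInB => //.
  exact/polyInZ/polyIn_sphere_poly.
- by move=> l; have [] := Hr l.
transitivity (\sum_l (F' l - lam *: h l ^+ 2 + \sum_(g <- G l) g * sigma g)).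
  by apply: eq_bigr => l _; rewrite /F'; ring.
rewrite big_split sumrB /= Ft -sumrB -big_split /=; apply: eq_bigr => l _.
have [_ _ ->] := Hr l; rewrite -/(h l) mulrBr -scalerAr expr2; ring.
Qed.

End SparsePutinar.

(** * Homogenization and the behaviour at infinity *)

Section HomogenizationEval.
Variables (R : realType) (n : nat).
Implicit Types (q : {mpoly R[n]}) (y : 'I_n.+1 -> R).

Lemma mdeg_tdeg q m : m \in msupp q -> (mdeg m <= tdeg q)%N.
Proof. by move=> /msize_mdeg_lt; rewrite /tdeg; case: (msize q). Qed.

Lemma meval_homogenize q y : meval y (homogenize q) =
  \sum_(m <- msupp q) mcoeff m q *
    (y ord0 ^+ (tdeg q - mdeg m) * \prod_(i < n) y (lift ord0 i) ^+ m i).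
Proof.
rewrite /homogenize (raddf_sum (meval y)) /=; apply: eq_bigr => m _.
rewrite mevalZ mevalM rmorphXn /= mevalXU rmorph_prod /=.
by congr (_ * (_ * _)); apply: eq_bigr => i _; rewrite rmorphXn /= mevalXU.
Qed.

Lemma meval_homogenize_scale q y c :
  meval (fun i => c * y i) (homogenize q) = c ^+ tdeg q * meval y (homogenize q).
Proof.
rewrite !meval_homogenize mulr_sumr; apply: eq_big_seq => m mq.
have -> : \prod_(i < n) (c * y (lift ord0 i)) ^+ m i =
          c ^+ mdeg m * \prod_(i < n) y (lift ord0 i) ^+ m i.
  under eq_bigr do rewrite exprMn.
  by rewrite big_split /= mdegE -expr_sum.
by rewrite exprMn -[in c ^+ tdeg q](subnK (mdeg_tdeg mq)) exprD [in LHS]mulrACA [LHS]mulrCA.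
Qed.

Lemma meval_dehomogenize q y : 0 < y ord0 ->
  meval y (homogenize q) =
    y ord0 ^+ tdeg q * meval (fun i => y (lift ord0 i) / y ord0) q.
Proof.
move=> y0; have yE : y = fun i => y ord0 * (y i / y ord0).
  by apply/funext => i; rewrite mulrCA mulfV ?mulr1// gt_eqF.
rewrite {1}yE meval_homogenize_scale meval_homogenize mevalE; congr (_ * _).
by apply: eq_bigr => m _; rewrite mulfV ?gt_eqF// expr1n mul1r.
Qed.

End HomogenizationEval.

(** A nonzero [y], once normalized, is a limit of points of [Ktilde] with positive first
    coordinate [x_0], where [f~ >= c x_0^d] for a lower bound [c] of [f] on the
    feasible set; so the polynomial [f~ - c x_0^d] cannot be negative at [y],
    where it equals [f~]. *)
Lemma homogenize_ge0_at_infinity (R : realType) (n m : nat) (f : {mpoly R[n]})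
    (g : 'I_m -> {mpoly R[n]}) (y : 'I_n.+1 -> R) :
  (-oo < fmin f g)%E -> closed_at_infinity g -> (0 < tdeg f)%N ->
  y ord0 = 0 -> (forall j, 0 <= meval y (homogenize (g j))) ->
  0 <= meval y (homogenize f).
Proof.
move=> fmin_gt closed_g df y0 yg.
have [c Hc] : exists c, forall u, feasible g u -> c <= meval (u 0) f.
  (* If fmin is +oo there is no feasible point, and any value will do. *)
  exists (fine (fmin f g)) => u gu.
  have : (fmin f g <= (meval (u 0) f)%:E)%E by apply: ereal_inf_lbound; exists u.
  by case: (fmin f g) fmin_gt => // r _; rewrite lee_fin.
have [yz|ynz] := pselect (forall i, y i = 0).
  have -> : y = fun i => 0 * y i by apply/funext => i; rewrite mul0r yz.
  by rewrite meval_homogenize_scale expr0n eqn0Ngt df mul0r.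
pose S := \sum_i y i ^+ 2.
have S0 : 0 < S.
  rewrite lt_neqAle sumr_ge0 ?andbT => [|i _]; last exact: sqr_ge0.
  apply/eqP => /esym/eqP; rewrite psumr_eq0 => [/allP h|i _]; last exact: sqr_ge0.
  apply: ynz => i; have /= := h i (mem_index_enum i).
  by rewrite sqrf_eq0 => /eqP.
pose r := Num.sqrt S; have r0 : 0 < r by rewrite sqrtr_gt0.
pose w : 'rV[R]_n.+1 := \row_i (r^-1 * y i).
have wE : w 0 = (fun i => r^-1 * y i) by apply/funext => i; rewrite mxE.
have Kw : Ktilde g w.
  split.
  - move=> j; rewrite wE meval_homogenize_scale mulr_ge0// exprn_ge0//.
    by rewrite invr_ge0 ltW.
  - by rewrite wE y0 mulr0.
  rewrite wE; under eq_bigr do rewrite exprMn.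
  rewrite -mulr_sumr exprVn -/S sqr_sqrtr ?(ltW S0)// mulVf// gt_eqF//.
suff : 0 <= meval (w 0) (homogenize f).
  by rewrite wE meval_homogenize_scale pmulr_rge0// exprn_gt0// invr_gt0.
rewrite leNgt; apply/negP => fw.
pose phi := homogenize f - c *: mvar R ord0 ^+ tdeg f.
have phiE (v : 'rV[R]_n.+1) :
    meval (v 0) phi = meval (v 0) (homogenize f) - c * v 0 ord0 ^+ tdeg f.
  by rewrite mevalB mevalZ rmorphXn /= mevalXU.
have phiw : meval (w 0) phi < 0.
  by rewrite phiE wE y0 mulr0 expr0n eqn0Ngt df mulr0 subr0 -wE.
rewrite closed_g in Kw.
have [v [[[vg v0 _] /= v0'] /=]] : (Ktilde g `&` [set x | 0 < x 0 ord0] `&`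
    [set v : 'rV[R]_n.+1 | meval (v 0) phi < 0]) !=set0.
  apply: Kw.
  have : open [set v : 'rV[R]_n.+1 | meval (v 0) phi < 0].
    rewrite (_ : [set v | _] = (fun v : 'rV[R]_n.+1 => meval (v 0) phi) @^-1`
       [set x | x < 0])//.
    by apply: open_comp; [move=> v _; exact: meval_continuous|exact: open_lt].
  by move=> oA; apply: open_nbhs_nbhs; split.
rewrite phiE meval_dehomogenize// mulrC -mulrBl pmulr_llt0 ?exprn_gt0// subr_lt0.
apply/negP; rewrite -leNgt.
pose u : 'rV[R]_n := \row_i (v 0 (lift ord0 i) / v 0 ord0).
have uE : u 0 = (fun i => v 0 (lift ord0 i) / v 0 ord0).
  by apply/funext => i; rewrite mxE.
rewrite -uE; apply: Hc => j; rewrite uE.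
by have := vg j; rewrite meval_dehomogenize// pmulr_rge0// exprn_gt0.
Qed.

(** * The sparse reformulation *)

Section SparseReform.
Variables (R : realType) (n m p : nat).
Variables (f : {mpoly R[n]}) (g : 'I_m -> {mpoly R[n]}).
Variables (X : 'I_p -> {set 'I_n}) (J : 'I_p -> {set 'I_m}).
Implicit Types (z : 'I_(n.+1 + p) -> R) (q : {mpoly R[n]}).

Lemma ix_inj : injective (@ix n p).
Proof. by move=> i j /lshift_inj /lift_inj. Qed.

Lemma mem_Vset_x0 l : ix0 n p \in Vset X l.
Proof. by rewrite !inE eqxx. Qed.

Lemma mem_Vset_x i l : (ix p i \in Vset X l) = (i \in X l).
Proof.
rewrite !inE (mem_imset _ _ ix_inj) /ix /ix0 /iw.
by rewrite eq_lrshift.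
Qed.

Lemma mem_Vset_w l l' : (iw n l' \in Vset X l) = (l' == l).
Proof.
rewrite !inE /iw /ix0 eq_rlshift orFb eq_rshift.
case: eqP => //= _; apply/imsetP => -[i _ /eqP].
by rewrite /ix eq_rlshift.
Qed.

Lemma hpolE l : hpol R X l = sphere_poly R (Vset X l).
Proof.
rewrite /hpol /sphere_poly /Vset big_setU1 /=; last first.
  rewrite !inE /ix0 /iw eq_lrshift orFb; apply/imsetP => -[i _ /eqP].
  by rewrite /ix eq_lshift.
rewrite big_setU1 /=; last first.
  by apply/imsetP => -[i _ /eqP]; rewrite /iw /ix eq_rlshift.
rewrite big_imset /=; last by move=> i j _ _ /ix_inj.
by congr (_ - _); rewrite -addrA; congr (_ + _); rewrite addrC.
Qed.

Lemma RIP_Vset : RIP X -> RIP (Vset X).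
Proof.
move=> rip l l0; have [s sl Hs] := rip l l0; exists s => //.
apply/fintype.subsetP => v; rewrite !inE => /andP[/or3P[/eqP->|/eqP->|]].
- by rewrite eqxx.
- by move=> /bigcupP[j jl]; rewrite mem_Vset_w => /eqP lj; rewrite lj ltnn in jl.
move=> /imsetP[i iX ->] /bigcupP[j jl]; rewrite mem_Vset_x => iXj.
have iXs : i \in X s.
  by apply: (fintype.subsetP Hs); rewrite inE iX; apply/bigcupP; exists j.
by have := mem_Vset_x i s; rewrite !inE => ->.
Qed.

Lemma tildeE q : tilde p q = \sum_(a <- msupp q) mcoeff a q *:
   (mvar R (ix0 n p) ^+ (tdeg q - mdeg a) * \prod_(i < n) mvar R (ix p i) ^+ a i).
Proof.
rewrite /tilde /homogenize (raddf_sum (comp_mpoly _)) /=; apply: eq_bigr => a _.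
have X1 (i : 'I_n.+1) : comp_mpoly [tuple mvar R (lshift p i) | i < n.+1]
    (mpolyX R (mnm1 i)) = mvar R (lshift p i).
  by rewrite comp_mpolyXU -tnth_nth tnth_mktuple.
rewrite comp_mpolyZ rmorphM rmorphXn /= X1 rmorph_prod /=; congr (_ *: (_ * _)).
by apply: eq_bigr => i _; rewrite rmorphXn /= X1.
Qed.

Lemma meval_tilde q z :
  meval z (tilde p q) = meval (fun i => z (lshift p i)) (homogenize q).
Proof.
rewrite comp_mpoly_meval; apply: meval_eq => i.
by rewrite tnth_mktuple mevalXU.
Qed.

Lemma polyIn_tilde_term q (a : multinom n) l :
  (forall i, a i != 0%N -> i \in X l) ->
  polyIn (Vset X l) (mcoeff a q *: (mvar R (ix0 n p) ^+ (tdeg q - mdeg a)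
                               * \prod_(i < n) mvar R (ix p i) ^+ a i)).
Proof.
move=> aX; apply/polyInZ/polyInM.
  exact/polyInXn/polyIn_mvar/mem_Vset_x0.
apply: polyIn_prod => i _; have [->|ai] := eqVneq (a i) 0%N.
  by rewrite expr0; apply: polyIn1.
by apply/polyInXn/polyIn_mvar; rewrite mem_Vset_x aX.
Qed.

Lemma polyIn_tilde q l : polyIn (X l) q -> polyIn (Vset X l) (tilde p q).
Proof.
move=> Xq; rewrite tildeE big_seq; apply: polyIn_sum => a aq.
exact/polyIn_tilde_term/Xq.
Qed.

Definition separable (q : {mpoly R[n.+1 + p]}) :=
  exists2 F : 'I_p -> {mpoly R[n.+1 + p]},
    (forall l, polyIn (Vset X l) (F l)) & q = \sum_l F l.

Lemma separable_polyIn l (q : {mpoly R[n.+1 + p]}) : polyIn (Vset X l) q -> separable q.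
Proof.
move=> Vq; exists (fun l' => if l' == l then q else 0).
  by move=> l'; case: eqP => [->|_] //; apply: polyIn0.
by rewrite -big_mkcond big_pred1_eq.
Qed.

Lemma separable0 : separable 0.
Proof. by exists (fun=> 0) => [l|]; [exact: polyIn0|rewrite big1]. Qed.

Lemma separableD (q1 q2 : {mpoly R[n.+1 + p]}) :
  separable q1 -> separable q2 -> separable (q1 + q2).
Proof.
move=> [F1 V1 ->] [F2 V2 ->]; exists (fun l => F1 l + F2 l).
  by move=> l; apply: polyInD.
by rewrite big_split.
Qed.

Lemma separableZ c (q : {mpoly R[n.+1 + p]}) : separable q -> separable (c *: q).
Proof.
move=> [F V ->]; exists (fun l => c *: F l); last by rewrite scaler_sumr.
by move=> l; apply: polyInZ.
Qed.

Lemma separable_sum (I : eqType) (r : seq I) (F : I -> {mpoly R[n.+1 + p]}) :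
  (forall i, i \in r -> separable (F i)) -> separable (\sum_(i <- r) F i).
Proof.
move=> VF; rewrite big_seq; apply: big_ind => //; first exact: separable0.
by move=> *; exact: separableD.
Qed.

(** The blocks' polynomials [fl] may share cancelling monomials, but each monomial
    of [f] survives in one of them; homogenizing [f] monomial by monomial
    therefore preserves the sparsity. *)
Lemma separable_shifted eps gamma : (0 < p)%N -> csp f g X J ->
  separable (shifted p f eps gamma).
Proof.
move=> p0 [Xcover [fl Xfl fE] _ _ _].
have sep_mono (v : 'I_(n.+1 + p)) l k : v \in Vset X l -> separable (mvar R v ^+ k).
  by move=> vV; apply: (@separable_polyIn l); apply/polyInXn/polyIn_mvar.
have sep0 k : separable (mvar R (ix0 n p) ^+ k).
  exact: sep_mono (mem_Vset_x0 (Ordinal p0)).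
rewrite /shifted /Feps -scaleNr; apply: separableD; last exact: separableZ.
apply: separableD.
  rewrite tildeE; apply: separable_sum => a af.
  have [l al] : exists l, a \in msupp (fl l).
    apply: contrapT => H; move: af; rewrite mcoeff_msupp fE raddf_sum /= big1 ?eqxx//.
    by move=> l _; apply: memN_msupp_eq0; apply/negP => al; apply: H; exists l.
  by apply: (@separable_polyIn l); apply: polyIn_tilde_term; apply: Xfl.
apply: separableZ; apply: separableD; last first.
  by apply: separable_sum => l _; apply: (sep_mono _ l); rewrite mem_Vset_w.
apply: separableD => //; apply: separable_sum => i _.
have : i \in (\bigcup_l X l)%SET by rewrite Xcover inE.
by move=> /bigcupP[l _ il]; apply: (sep_mono _ l); rewrite mem_Vset_x.
Qed.

Lemma meval_Feps eps z : meval z (Feps p f eps) = meval z (tilde p f)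
  + eps * \sum_v z v ^+ d0 f.
Proof.
rewrite /Feps mevalD mevalZ; congr (_ + _ * _).
rewrite !mevalD !(raddf_sum (meval z)) /= big_split_ord /= big_ord_recl.
by congr (_ + _ + _); [|apply: eq_bigr => i _..]; rewrite rmorphXn /= mevalXU.
Qed.

Lemma meval_shifted eps gamma z : meval z (shifted p f eps gamma) =
  meval z (Feps p f eps) - gamma * z (ix0 n p) ^+ tdeg f.
Proof. by rewrite mevalB mevalZ rmorphXn /= mevalXU. Qed.

Lemma meval_hpol l z :
  meval z (hpol R X l) = \sum_(v in Vset X l) z v ^+ 2 - 1.
Proof.
rewrite hpolE mevalB meval1 (raddf_sum (meval z)) /=; congr (_ - _).
by apply: eq_bigr => v _; rewrite rmorphXn /= mevalXU.
Qed.

(** Let [gamma < gamma'] with [gamma'] in the set whose supremum is [f_eps]. If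
    [x_0^d > 0], the gap [(gamma' - gamma) x_0^d] suffices. Otherwise [d > 0]
    and [x_0 = 0], and the sphere equation of any block forbids that all
    coordinates vanish. *)
Lemma shifted_positive eps gamma (z : 'rV[R]_(n.+1 + p)) :
  (0 < p)%N -> 0 < eps -> (-oo < fmin f g)%E -> closed_at_infinity g ->
  (gamma%:E < f_eps f g X eps)%E -> Ks1 g X z ->
  0 < meval (z 0) (shifted p f eps gamma).
Proof.
move=> p0 eps0 fmin_gt closed_g gamma_lt Kz.
have [_ [gamma' Hg' <-]] := ereal_sup_gt gamma_lt; rewrite lte_fin => gg'.
have [x0 zg zh] := Kz.
have := Hg' z Kz; rewrite !meval_shifted => H.
have [|] := ltP 0 (z 0 (ix0 n p) ^+ tdeg f).
  move: (meval _ _) (_ ^+ tdeg f) H => A x H x1.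
  have : 0 < (gamma' - gamma) * x by rewrite mulr_gt0// subr_gt0.
  lra.
rewrite le_eqVlt ltNge exprn_ge0// orbF expf_eq0 => /andP[df /eqP z0].
rewrite z0 expr0n eqn0Ngt df mulr0 subr0 meval_Feps.
apply: ltr_wpDl.
  rewrite meval_tilde; apply: (homogenize_ge0_at_infinity fmin_gt closed_g df) => //.
  by move=> j; have := zg j; rewrite meval_tilde.
have ev v : 0 <= z 0 v ^+ d0 f by rewrite /d0 exprM exprn_ge0// sqr_ge0.
rewrite pmulr_rgt0// lt_neqAle sumr_ge0 ?andbT => [|v _]; last exact: ev.
apply/eqP => /esym/eqP; rewrite psumr_eq0 => [/allP h|v _]; last exact: ev.
have zv v : z 0 v = 0.
  have /= := h v (mem_index_enum v).
  by rewrite expf_eq0 => /andP[_ /eqP].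
have := zh (Ordinal p0); rewrite meval_hpol big1 ?sub0r => [|v _].
  by move/eqP; rewrite oppr_eq0 oner_eq0.
by rewrite zv expr0n.
Qed.

Definition block_constraints l : seq {mpoly R[n.+1 + p]} :=
  mvar R (ix0 n p) :: [seq tilde p (g j) | j <- enum (J l)].

Lemma sparse_cone_ge0 k (q : {mpoly R[n.+1 + p]}) (z : 'rV[R]_(n.+1 + p)) :
  sparse_cone g X J k q -> Ks1 g X z -> 0 <= meval (z 0) q.
Proof.
move=> [a [b [Ha Hb ->]]] [x0 zg zh].
rewrite (raddf_sum (meval (z 0))) /=; apply: sumr_ge0 => l _.
have [q' _ <-] := Ha l.
have [s [sig [[Vs _] Hsig ->]]] := Hb l.
rewrite mevalD mevalM zh mul0r add0r mevalD addr_ge0 ?(sos_ge0 _ Vs)//.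
rewrite (raddf_sum (meval (z 0))) /= big_seq; apply: sumr_ge0 => h hG.
have [Vh _] := Hsig h hG; rewrite mevalM mulr_ge0 ?(sos_ge0 _ Vh)//.
move: hG; rewrite inE => /orP[/eqP->|/mapP[j _ ->]//].
by rewrite mevalXU.
Qed.

Lemma f_relax_le eps k : (f_relax f g X J eps k <= f_eps f g X eps)%E.
Proof.
apply: le_ereal_sup => _ [gamma Hg <-]; exists gamma => // z Kz.
exact: sparse_cone_ge0 Hg Kz.
Qed.

Lemma degLe_msize (q : {mpoly R[n.+1 + p]}) (a b : nat) :
  (msize q + b <= a)%N -> degLe (a%:Z - b%:Z) q.
Proof.
move=> ab a' /msize_mdeg_lt H; rewrite lerBrDr -PoszD lez_nat; lia.
Qed.

Lemma sparse_cone_large (q : {mpoly R[n.+1 + p]}) r s sigma :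
  (forall l, polyIn (Vset X l) (r l)) -> (forall l, sos (Vset X l) (s l)) ->
  (forall l h, h \in block_constraints l -> sos (Vset X l) (sigma h)) ->
  q = \sum_l (sphere_poly R (Vset X l) * r l
              + (s l + \sum_(h <- block_constraints l) h * sigma h)) ->
  exists k0, forall k, (k0 <= k)%N -> sparse_cone g X J k q.
Proof.
move=> Vr Vs Vsig qE.
pose w h := (msize (sigma h) + 2 * uphalf (tdeg h))%N.
pose b l := (msize (r l) + tdeg (hpol R X l) + msize (s l)
             + \sum_(h <- block_constraints l) w h)%N.
exists (\sum_l b l)%N => k kk.
have bk l : (b l <= k)%N by apply: leq_trans kk; rewrite (bigD1 l)//= leq_addr.
exists (fun l => hpol R X l * r l),
       (fun l => s l + \sum_(h <- block_constraints l) h * sigma h).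
split.
- move=> l; exists (r l) => //; split=> //; apply: degLe_msize.
  by have := bk l; rewrite /b; lia.
- move=> l; exists (s l), sigma; split=> //.
    split=> //; rewrite -[X in degLe X]subr0; apply: degLe_msize.
    by have := bk l; rewrite /b; lia.
  move=> h hG; split; first exact: (Vsig l).
  apply: degLe_msize; have := bk l; rewrite /b (big_rem h)//= /w; lia.
by rewrite qE; apply: eq_bigr => l _; rewrite hpolE.
Qed.

End SparseReform.

(** * Convergence of the hierarchy *)

Lemma cvg_ereal_from_below (R : realType) (u : nat -> \bar R) (l : \bar R) :
  (forall k, (u k <= l)%E) ->
  (forall c : R, (c%:E < l)%E -> exists k0, forall k, (k0 <= k)%N -> (c%:E <= u k)%E) ->
  u k @[k --> \oo] --> l.
Proof.
case: l => [l| |] ul lu.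
- apply/fine_cvgP; split.
    have [k0 H] := lu (l - 1) ltac:(by rewrite lte_fin; lra).
    exists k0 => // k /= kk; have := H k kk; have := ul k.
    by case: (u k).
  apply/cvgrPdist_le => e e0.
  have [k0 H] := lu (l - e) ltac:(by rewrite lte_fin; lra).
  exists k0 => // k /= kk; have := H k kk; have := ul k.
  case: (u k) => [x| |]//; rewrite !lee_fin /= => h1 h2.
  by rewrite ger0_norm; lra.
- apply/cvgeyPge => A; have [k0 H] := lu A ltac:(by rewrite ltry).
  by exists k0.
- rewrite (_ : u = fun=> -oo%E); first exact: cvg_cst.
  by apply/funext => k; have := ul k; rewrite leeNy_eq => /eqP.
Qed.

(** With no block there is no sphere equation, but then [f = 0], there is no
    variable besides [x_0], and the optimal values all equal [eps]. *)
Section NoBlocks.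
Variables (R : realType) (n m : nat).
Variables (f : {mpoly R[n]}) (g : 'I_m -> {mpoly R[n]}).
Variables (X : 'I_0 -> {set 'I_n}) (J : 'I_0 -> {set 'I_m}) (eps : R).

Lemma shifted_no_blocks gamma : csp f g X J ->
  shifted 0 f eps gamma = (eps - gamma)%:A.
Proof.
move=> [Xcover [fl _ fE] _ _ _].
have f0 : f = 0 by rewrite fE big_ord0.
have no_var (i : 'I_n) : False.
  by have : i \in (\bigcup_l X l)%SET; [rewrite Xcover inE|rewrite big_ord0 inE].
have d00 : d0 f = 0%N by rewrite /d0 /tdeg f0 msize0.
have sum0 (a : 'I_n -> {mpoly R[n.+1 + 0]}) : \sum_i a i = 0.
  by rewrite big1// => i _; have := no_var i.
rewrite /shifted /Feps d00 sum0 big_ord0.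
rewrite f0 /tilde /homogenize msupp0 big_nil raddf0 add0r !addr0.
by rewrite /tdeg msize0 !expr0 scalerBl.
Qed.

Lemma f_eps_no_blocks : csp f g X J -> (f_eps f g X eps <= eps%:E)%E.
Proof.
move=> pattern; have [_ _ Jcover _ _] := pattern.
apply: ge_ereal_sup => _ [gamma Hg <-]; rewrite lee_fin -subr_ge0.
have := Hg 0; rewrite shifted_no_blocks// mevalZ meval1 mulr1; apply.
split=> [|j|[]//]; first by rewrite mxE.
by have : j \in (\bigcup_l J l)%SET; [rewrite Jcover inE|rewrite big_ord0 inE].
Qed.

Lemma f_relax_no_blocks k : csp f g X J -> (eps%:E <= f_relax f g X J eps k)%E.
Proof.
move=> pattern; apply: ereal_sup_ubound; exists eps => //=.
exists (fun=> 0), (fun=> 0); split; [by case|by case|].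
by rewrite big_ord0 shifted_no_blocks// subrr scale0r.
Qed.

End NoBlocks.

(** The certificate of [sparse_putinar] is one fixed expression, so its degrees
    fit below [2k] for all large [k]. *)
Lemma relax_eventually_ge (R : realType) (n m p : nat)
    (f : {mpoly R[n]}) (g : 'I_m -> {mpoly R[n]})
    (X : 'I_p -> {set 'I_n}) (J : 'I_p -> {set 'I_m}) (eps c : R) :
  (0 < p)%N -> (-oo < fmin f g)%E -> closed_at_infinity g -> csp f g X J ->
  RIP X -> 0 < eps -> (c%:E < f_eps f g X eps)%E ->
  exists k0, forall k, (k0 <= k)%N -> (c%:E <= f_relax f g X J eps k)%E.
Proof.
move=> p0 fmin_gt closed_g pattern rip eps0 c_lt.
have [F VF FE] := separable_shifted eps c p0 pattern.
have [_ _ Jcover _ gX] := pattern.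
have [||r [s [sigma [Vr Vs Vsig E]]]] := @sparse_putinar R _ p (Vset X)
    (block_constraints g J) F (RIP_Vset rip) VF.
- move=> l h; rewrite inE => /orP[/eqP->|/mapP[j + ->]].
    exact/polyIn_mvar/mem_Vset_x0.
  by rewrite mem_enum => jJ; apply: polyIn_tilde; apply: gX.
- move=> z zh zG; rewrite -FE; apply: shifted_positive fmin_gt closed_g c_lt _ => //.
  split=> [|j|l]; last by rewrite hpolE.
    by have := zG (Ordinal p0) _ (mem_head _ _); rewrite mevalXU.
  have : j \in (\bigcup_l J l)%SET by rewrite Jcover inE.
  move=> /bigcupP[l _ jl]; apply: (zG l); rewrite in_cons; apply/orP; right.
  by apply: (map_f (fun j => tilde p (g j))); rewrite mem_enum.
rewrite -FE in E.
have [k0 H] := sparse_cone_large Vr Vs Vsig E.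
by exists k0 => k /H Hk; apply: ereal_sup_ubound; exists c.
Qed.

Unset Implicit Arguments.

Theorem theorem3p4 (R : realType) (n m p : nat)
    (f : {mpoly R[n]}) (g : 'I_m -> {mpoly R[n]})
    (X : 'I_p -> {set 'I_n}) (J : 'I_p -> {set 'I_m}) :
  (-oo < fmin f g)%E ->
  closed_at_infinity g ->
  csp f g X J ->
  RIP X ->
  forall eps : R, 0 < eps ->
    f_relax f g X J eps k @[k --> \oo] --> f_eps f g X eps.
Proof.
move=> fmin_gt closed_g pattern rip eps eps0.
apply: cvg_ereal_from_below => [k|c c_lt]; first exact: f_relax_le.
have [p0|p0] := posnP p; last exact: relax_eventually_ge.
move: X J pattern rip c_lt; rewrite p0 => X' J' pattern _ c_lt; exists 0%N => k _.
apply: le_trans (ltW c_lt) _.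
exact: le_trans (f_eps_no_blocks eps pattern) (f_relax_no_blocks eps k pattern).
Qed.
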